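(* Let $M=(m_{ij})_{i,j\in I}$, $M'=(m'_{ij})_{i,j\in I'}$ be Coxeter matrices over finite sets $I$, $I'$ and let $(W(M),\star)$ and $(W(M'),\star)=\langle s'_i: i\in I'\rangle$ be the respective Hecke monoids. (a) Given a family $\boldsymbol K=\{K_i\,:\,i\in I'\}$ of subsets of $I$ such that each $W_{K_i}(M)$ is finite, the assignments $s'_i\mapsto w_\circ^{K_i}$, $i\in I'$, define a homomorphism $\phi_{\boldsymbol K}:(W(M'),\star)\to (W(M),\star)$ if and only if for all $i\neq j\in I'$ either $m'_{ij}=\infty$, or $W_{K_i\cup K_j}(M)$ is finite and $$m'_{ij}\ge \max(\mu_M(K_i,K_j),\mu_M(K_j,K_i)),$$ where $\mu_M(K_i,K_j)$ is the minimal positive integer $m$ such that the alternating product $w_\circ^{K_i}\star w_\circ^{K_j}\star w_\circ^{K_i}\star\cdots$ with $m$ factors is equal to $w_\circ^{K_i\cup K_j}$. (b) All homomorphisms of Hecke monoids $(W(M'),\star)\to(W(M),\star)$ are of this form.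
   Context: A Coxeter matrix over a finite set $I$ is a symmetric matrix $M=(m_{ij})_{i,j\in I}$ with $m_{ii}=1$ and $m_{ij}\in\mathbb Z_{\ge 2}\cup\{\infty\}$ for $i\ne j$. The Coxeter group $W(M)$ is generated by $s_i$, $i\in I$, subject to $(s_is_j)^{m_{ij}}=1$ whenever $m_{ij}\neq\infty$; $\ell$ is its length function. The Hecke monoid $(W(M),\star)$ is the monoid generated by $s_i$, $i\in I$, subject to $s_i\star s_i=s_i$ and $s_i\star s_j\star\cdots=s_j\star s_i\star\cdots$ ($m_{ij}$ factors on each side) for $i\ne j$ with $m_{ij}<\infty$. Its underlying set is identified with $W(M)$ so that $s_i\star w=s_iw$ if $\ell(s_iw)>\ell(w)$ and $s_i\star w=w$ otherwise (and similarly on the right). Homomorphisms of monoids map identity to identity. For $J\subset I$, $W_J(M)$ is the subgroup generated by $s_j$, $j\in J$ (trivial if $J=\emptyset$). If $W_J(M)$ is finite, $w_\circ^J$ denotes its longest element. If $W_{J\cup K}(M)$ is finite, an integer $m$ as in the definition of $\mu_M(J,K)$ always exists. *)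

(* Defs.v *)
From HB Require Import structures.
From mathcomp Require Import all_boot.
From mathcomp Require Import generic_quotient.
From mathcomp Require Import boolp classical_sets functions cardinality.

Set Implicit Arguments.
Unset Strict Implicit.
Unset Printing Implicit Defensive.

Local Open Scope quotient_scope.
Local Open Scope group_scope.

Inductive word_cong (I : Type) (R : seq I -> seq I -> Prop) :
    seq I -> seq I -> Prop :=
| WordStep x y u v : R u v -> word_cong R (x ++ u ++ y) (x ++ v ++ y)
| WordRefl u : word_cong R u u
| WordSym u v : word_cong R u v -> word_cong R v u
| WordTrans v u w : word_cong R u v -> word_cong R v w -> word_cong R u w.

Lemma word_cong_cat (I : Type) (R : seq I -> seq I -> Prop) x y u v :
  word_cong R u v -> word_cong R (x ++ u ++ y) (x ++ v ++ y).
Proof.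
elim=> {u v} [x' y' u v Ruv|u|u v _ IH|v u w _ IH1 _ IH2].
- by have := WordStep (x ++ x') (y' ++ y) Ruv; rewrite -!catA.
- exact: WordRefl.
- exact: WordSym.
- exact: WordTrans IH1 IH2.
Qed.

Definition word_eqv (I : choiceType) (R : seq I -> seq I -> Prop) : rel (seq I) :=
  fun u v => `[< word_cong R u v >].

Lemma word_eqv_refl (I : choiceType) (R : seq I -> seq I -> Prop) :
  reflexive (word_eqv R).
Proof. by move=> u; apply/asboolP/WordRefl. Qed.

Lemma word_eqv_sym (I : choiceType) (R : seq I -> seq I -> Prop) :
  symmetric (word_eqv R).
Proof. by move=> u v; apply/asboolP/asboolP => /WordSym. Qed.

Lemma word_eqv_trans (I : choiceType) (R : seq I -> seq I -> Prop) :
  transitive (word_eqv R).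
Proof.
move=> v u w /asboolP uv /asboolP vw; apply/asboolP; exact: WordTrans uv vw.
Qed.

Canonical word_equiv (I : choiceType) (R : seq I -> seq I -> Prop) :=
  EquivRel (word_eqv R) (word_eqv_refl R) (word_eqv_sym R) (@word_eqv_trans I R).

Definition presented (I : choiceType) (R : seq I -> seq I -> Prop) : Type :=
  {eq_quot word_equiv R}.
HB.instance Definition _ (I : choiceType) (R : seq I -> seq I -> Prop) :=
  EqQuotient.copy (presented R) {eq_quot word_equiv R}.
HB.instance Definition _ (I : choiceType) (R : seq I -> seq I -> Prop) :=
  Choice.copy (presented R) {eq_quot word_equiv R}.

Definition word_class (I : choiceType) (R : seq I -> seq I -> Prop) (u : seq I) :
  presented R := \pi_(presented R) u.

Definition pgen (I : choiceType) (R : seq I -> seq I -> Prop) (i : I) :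
  presented R := word_class R [:: i].

Definition pmul (I : choiceType) (R : seq I -> seq I -> Prop)
    (x y : presented R) : presented R := word_class R (repr x ++ repr y).

Lemma word_classP (I : choiceType) (R : seq I -> seq I -> Prop) u v :
  word_class R u = word_class R v <-> word_cong R u v.
Proof.
split=> [/eqmodP/asboolP //|uv]; by apply/eqmodP/asboolP.
Qed.

Lemma word_class_repr (I : choiceType) (R : seq I -> seq I -> Prop)
  (x : presented R) : word_class R (repr x) = x.
Proof. exact: reprK. Qed.

Lemma pmulE (I : choiceType) (R : seq I -> seq I -> Prop) u v :
  pmul (word_class R u) (word_class R v) = word_class R (u ++ v).
Proof.
apply/word_classP.
have /word_classP hu := word_class_repr (word_class R u).
have /word_classP hv := word_class_repr (word_class R v).
apply: (@WordTrans _ _ (u ++ repr (word_class R v))).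
- exact: (word_cong_cat [::] _ hu).
- by have := word_cong_cat u [::] hv; rewrite !cats0.
Qed.

Lemma pmulA (I : choiceType) (R : seq I -> seq I -> Prop) :
  associative (@pmul I R).
Proof.
move=> x y z; rewrite -(word_class_repr x) -(word_class_repr y).
by rewrite -(word_class_repr z) !pmulE catA.
Qed.

Lemma pmul1x (I : choiceType) (R : seq I -> seq I -> Prop) :
  left_id (word_class R [::]) (@pmul I R).
Proof. by move=> x; rewrite -(word_class_repr x) pmulE. Qed.

Lemma pmulx1 (I : choiceType) (R : seq I -> seq I -> Prop) :
  right_id (word_class R [::]) (@pmul I R).
Proof. by move=> x; rewrite -(word_class_repr x) pmulE cats0. Qed.

HB.instance Definition _ (I : choiceType) (R : seq I -> seq I -> Prop) :=
  isMonoid.Build (presented R) (@pmulA I R) (@pmul1x I R) (@pmulx1 I R).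

Lemma word_class_cat (I : choiceType) (R : seq I -> seq I -> Prop) u v :
  word_class R (u ++ v) = word_class R u * word_class R v.
Proof. by rewrite -pmulE. Qed.

Lemma prod_pgen (I : choiceType) (R : seq I -> seq I -> Prop) (u : seq I) :
  \prod_(i <- u) pgen R i = word_class R u.
Proof.
elim: u => [|i u IH]; first by rewrite big_nil.
by rewrite big_cons IH -word_class_cat.
Qed.

Lemma word_cong_prod (I : choiceType) (R : seq I -> seq I -> Prop)
    (G : monoidType) (g : I -> G) :
  (forall u v, R u v -> \prod_(i <- u) g i = \prod_(i <- v) g i) ->
  forall u v, word_cong R u v -> \prod_(i <- u) g i = \prod_(i <- v) g i.
Proof.
move=> gR u v; elim=> {u v} [x y u v /gR uv|//|u v _ -> //|v u w _ -> _ -> //].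
by rewrite !big_cat /= uv.
Qed.

Lemma presented_univ (I : choiceType) (R : seq I -> seq I -> Prop)
    (G : monoidType) (g : I -> G) :
  (forall u v, R u v -> \prod_(i <- u) g i = \prod_(i <- v) g i) ->
  exists f : UMagmaMorphism.type (presented R) G,
    forall i, f (pgen R i) = g i.
Proof.
move=> /word_cong_prod gR.
pose f (x : presented R) : G := \prod_(i <- repr x) g i.
have fE u : f (word_class R u) = \prod_(i <- u) g i.
  by apply: gR; apply/word_classP; apply: word_class_repr.
have fM : monoid_morphism f.
  split=> [|x y]; first by rewrite -[1]/(word_class R [::]) fE big_nil.
  rewrite -(word_class_repr x) -(word_class_repr y) -word_class_cat.
  by rewrite !fE big_cat.
pose F : UMagmaMorphism.type (presented R) G :=
  HB.pack f (isUMagmaMorphism.Build _ _ f fM).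
exists F => i; rewrite -[F _]/(f _).
by rewrite fE big_seq1.
Qed.

(* [None] encodes the label infinity. *)
Record coxeter_matrix (I : finType) := CoxeterMatrix {
  cox_entry :> I -> I -> option nat;
  cox_entry_sym : forall i j, cox_entry i j = cox_entry j i;
  cox_entry_diag : forall i, cox_entry i i = Some 1%N;
  cox_entry_off : forall i j m,
    i != j -> cox_entry i j = Some m -> (2 <= m)%N
}.

Inductive cox_rel (I : finType) (M : coxeter_matrix I) :
    seq I -> seq I -> Prop :=
| CoxRel i j m : M i j = Some m -> cox_rel M (flatten (nseq m [:: i; j])) [::].

(* Since m_ii = 1, the relations contain s_i s_i = 1: this monoid is a group,
   and it is the group with the same presentation (see [cox_univ]). *)
Definition coxeter (I : finType) (M : coxeter_matrix I) : Type :=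
  presented (cox_rel M).
HB.instance Definition _ (I : finType) (M : coxeter_matrix I) :=
  Monoid.copy (coxeter M) (presented (cox_rel M)).

Definition cox_gen (I : finType) (M : coxeter_matrix I) (i : I) : coxeter M :=
  pgen (cox_rel M) i.

Lemma cox_gen_sq (I : finType) (M : coxeter_matrix I) (i : I) :
  cox_gen M i * cox_gen M i = 1.
Proof.
rewrite /cox_gen /pgen -word_class_cat; apply/word_classP.
exact: (WordStep [::] [::] (CoxRel (cox_entry_diag M i))).
Qed.

Definition cox_inv (I : finType) (M : coxeter_matrix I) (x : coxeter M) :
  coxeter M := word_class (cox_rel M) (rev (repr (x : presented (cox_rel M)))).

Lemma word_class_revK (I : finType) (M : coxeter_matrix I) (u : seq I) :
  word_class (cox_rel M) (rev u) * word_class (cox_rel M) u = 1.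
Proof.
elim: u => [|i u IH]; first exact: mul1g.
rewrite rev_cons -cats1 -(cat1s i u) !word_class_cat -mulgA.
rewrite (mulgA (word_class _ [:: i])).
have -> : word_class (cox_rel M) [:: i] * word_class (cox_rel M) [:: i] = 1.
  exact: cox_gen_sq.
by rewrite mul1g.
Qed.

Lemma cox_mulVg (I : finType) (M : coxeter_matrix I) :
  left_inverse 1 (@cox_inv I M) *%g.
Proof. by move=> x; rewrite -{2}(word_class_repr x) word_class_revK. Qed.

Lemma cox_mulgV (I : finType) (M : coxeter_matrix I) :
  right_inverse 1 (@cox_inv I M) *%g.
Proof.
move=> x; rewrite -{1}(word_class_repr x) -[X in word_class _ X]revK.
exact: word_class_revK.
Qed.

HB.instance Definition _ (I : finType) (M : coxeter_matrix I) :=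
  hasInv.Build (coxeter M) (@cox_inv I M).
HB.instance Definition _ (I : finType) (M : coxeter_matrix I) :=
  Monoid_isGroup.Build (coxeter M) (@cox_mulVg I M) (@cox_mulgV I M).

Lemma cox_gen_rel (I : finType) (M : coxeter_matrix I) (i j : I) (m : nat) :
  M i j = Some m -> (cox_gen M i * cox_gen M j) ^+ m = 1.
Proof.
move=> Mij; have -> : (cox_gen M i * cox_gen M j) ^+ m =
    \prod_(k <- flatten (nseq m [:: i; j])) cox_gen M k.
  elim: m {Mij} => [|m IH]; first by rewrite big_nil.
  by rewrite expgS IH /= !big_cons mulgA.
rewrite (prod_pgen (cox_rel M)); apply/word_classP.
by have := WordStep [::] [::] (CoxRel Mij); rewrite !cats0.
Qed.

Lemma cox_univ (I : finType) (M : coxeter_matrix I) (G : groupType)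
    (g : I -> G) :
  (forall i j m, M i j = Some m -> (g i * g j) ^+ m = 1) ->
  exists f : UMagmaMorphism.type (coxeter M) G,
    forall i, f (cox_gen M i) = g i.
Proof.
move=> gM; apply: presented_univ => u v [i j m /gM].
move=> gm; rewrite big_nil -[RHS]gm; elim: m {gm} => [|m IH].
  by rewrite big_nil.
by rewrite /= !big_cons IH mulgA expgS.
Qed.

Lemma cox_lengthP (I : finType) (M : coxeter_matrix I) (w : coxeter M) :
  exists n, `[< exists2 u : seq I, size u = n & w = \prod_(i <- u) cox_gen M i >].
Proof.
exists (size (repr (w : presented (cox_rel M)))); apply/asboolP.
by exists (repr (w : presented (cox_rel M))); rewrite // prod_pgen word_class_repr.
Qed.

Definition cox_length (I : finType) (M : coxeter_matrix I) (w : coxeter M) : nat :=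
  ex_minn (cox_lengthP w).

Definition reduced_word (I : finType) (M : coxeter_matrix I) (w : coxeter M) :
    seq I :=
  xget [::] [set u : seq I |
    w = \prod_(i <- u) cox_gen M i /\ size u = cox_length w]%classic.

Definition is_subgroup (G : groupType) (H : set G) : Prop :=
  [/\ H 1, forall x y, H x -> H y -> H (x * y) & forall x, H x -> H x^-1].

Definition parabolic (I : finType) (M : coxeter_matrix I) (J : {set I}) :
    set (coxeter M) :=
  smallest (@is_subgroup (coxeter M)) [set cox_gen M j | j in [set` J]]%classic.
Arguments parabolic {I} M J.

(* The element of maximal length is unique. The default value 1 is only
   taken when W_J(M) is infinite. *)
Definition longest (I : finType) (M : coxeter_matrix I) (J : {set I}) :
    coxeter M :=
  xget 1 [set w : coxeter M | parabolic M J w /\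
    forall v, parabolic M J v -> (cox_length v <= cox_length w)%N]%classic.

Fixpoint alt_word (T : Type) (x y : T) (m : nat) : seq T :=
  if m is m'.+1 then x :: alt_word y x m' else [::].

Inductive hecke_rel (I : finType) (M : coxeter_matrix I) :
    seq I -> seq I -> Prop :=
| HeckeIdem i : hecke_rel M [:: i; i] [:: i]
| HeckeBraid i j m : i != j -> M i j = Some m ->
    hecke_rel M (alt_word i j m) (alt_word j i m).

Definition hecke (I : finType) (M : coxeter_matrix I) : Type :=
  presented (hecke_rel M).
HB.instance Definition _ (I : finType) (M : coxeter_matrix I) :=
  Monoid.copy (hecke M) (presented (hecke_rel M)).

Definition hecke_gen (I : finType) (M : coxeter_matrix I) (i : I) : hecke M :=
  pgen (hecke_rel M) i.

(* The identification of the set W(M) with the Hecke monoid. The rule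
   s_i \star w = s_i w if l(s_i w) > l(w) forces
   s_i1 ... s_ik |-> s_i1 \star ... \star s_ik for a reduced expression; by
   Matsumoto's theorem the result does not depend on the chosen one. *)
Definition to_hecke (I : finType) (M : coxeter_matrix I) (w : coxeter M) :
    hecke M :=
  \prod_(i <- reduced_word w) hecke_gen M i.

Definition alt_prod (G : monoidType) (x y : G) (m : nat) : G :=
  \prod_(z <- alt_word x y m) z.

Definition hecke_longest (I : finType) (M : coxeter_matrix I) (J : {set I}) :
    hecke M := to_hecke (longest M J).

Definition mu_set (I : finType) (M : coxeter_matrix I) (J K : {set I}) :
    set nat :=
  [set m | (0 < m)%N /\
    alt_prod (hecke_longest M J) (hecke_longest M K) m =
      hecke_longest M (J :|: K)]%classic.

(* [mu_set M J K] is nonempty as soon as W_(J u K)(M) is finite; [mu] is used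
   only in this case. *)
Definition mu (I : finType) (M : coxeter_matrix I) (J K : {set I}) : nat :=
  xget 0%N [set m | mu_set M J K m /\
    forall n, mu_set M J K n -> (m <= n)%N]%classic.

Definition mu_admissible (I I' : finType) (M : coxeter_matrix I)
    (M' : coxeter_matrix I') (K : I' -> {set I}) : Prop :=
  forall i j, i != j ->
    M' i j = None \/
    exists2 m, M' i j = Some m &
      finite_set (parabolic M (K i :|: K j)) /\
      (maxn (mu M (K i) (K j)) (mu M (K j) (K i)) <= m)%N.

(* Main.v *)
(** A homomorphism sends generators to idempotents satisfying the braid
    relations of [M'], so everything reduces to computing in the Hecke monoid.
    Sending a generator [s_i] to the subset {1, s_i} of [W(M)] defines a
    homomorphism from the Hecke monoid to the subsets of [W(M)] under
    pointwise product, since both sides of a braid relation go to the same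
    dihedral group. Every element of the Hecke monoid is given by a reduced
    word [u], the product of [u] in [W(M)] is the unique longest element of its
    image, and by Matsumoto's theorem it determines the element. So inclusion
    of images (the Bruhat order) is a partial order on the Hecke monoid, for
    which 1 is the least element and multiplication is monotone.
    Consequently an element [z] of the submonoid generated by [J] with
    [s_j * z = z] for all [j] in [J] dominates this submonoid, whence [W_J] is
    finite and [z = w_0^J]. This identifies all idempotents, and also the
    common value of two equal alternating products of [w_0^J] and [w_0^K],
    which must be [w_0^(J u K)].
    Matsumoto's theorem needs that [s_i s_j] has order exactly [m_ij]; this is
    read off the contragredient geometric representation, here over the
    algebraic numbers. *)

Require Import Defs.
From mathcomp Require Import all_boot.
From mathcomp Require Import all_algebra all_field.
From mathcomp Require Import ring.
From mathcomp Require Import boolp classical_sets functions cardinality.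

Set Implicit Arguments.
Unset Strict Implicit.
Unset Printing Implicit Defensive.

Local Open Scope group_scope.

(** Lets words act on [X] up to congruence; it serves both the geometric representation and the
    action on subsets. *)
Lemma word_cong_foldr (I : Type) (R : seq I -> seq I -> Prop) (X : Type)
    (f : I -> X -> X) :
  (forall u v, R u v -> foldr f ^~ u =1 foldr f ^~ v) ->
  forall u v, word_cong R u v -> foldr f ^~ u =1 foldr f ^~ v.
Proof.
move=> fR u v.
elim=> {u v} [x y u v /fR uv F|u F|u v _ IH F|v u w _ IH1 _ IH2 F] //=.
- by rewrite !foldr_cat uv.
- by rewrite IH1.
Qed.

(** * Orders of the products of two generators *)

Section GeometricRepresentation.
Import GRing.Theory Num.Theory.
Local Open Scope ring_scope.
Variables (I : finType) (M : coxeter_matrix I).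

(** Plays the role of exp(i pi / m): any primitive root of unity of order 2m will do. The value 1
    serves the label infinity; the label 0 never occurs. *)
Definition half_root (m : option nat) : algC :=
  if m is Some n.+1 then sval (C_prim_root_exists (ltn0Sn n.*2.+1)) else 1.

Lemma half_root_prim (n : nat) :
  (n.+1.*2).-primitive_root (half_root (Some n.+1)).
Proof. exact: (svalP (C_prim_root_exists (ltn0Sn n.*2.+1))). Qed.

Lemma half_root_neq0 (m : option nat) : half_root m != 0.
Proof.
case: m => [[|n]|]; rewrite ?oner_neq0 //.
have /prim_expr_order h := half_root_prim n.
apply/eqP => z0; move: h; rewrite z0 expr0n /= => /esym/eqP.
by rewrite oner_eq0.
Qed.

(* Up to Galois conjugation this is [- 2 cos (pi / m_ij)]; it is [-2] for the
   label infinity. *)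
Definition tits_form (i j : I) : algC :=
  - (half_root (M i j) + (half_root (M i j))^-1).

(** [F] lists the values of a linear form on the simple roots; [s_i] acts by precomposition with the
    reflection in the root [i]. *)
Definition contragredient (i : I) (F : I -> algC) : I -> algC :=
  fun k => F k - tits_form i k * F i.

Lemma tits_form_diag (i : I) : tits_form i i = 2.
Proof.
rewrite /tits_form cox_entry_diag.
have h := half_root_prim 0.
suff -> : half_root (Some 1%N) = -1 by rewrite invrN1; ring.
have := prim_expr_order h; move/eqP; rewrite sqrf_eq1 => /orP[|/eqP //] /eqP h1.
by have := prim_order_dvd h 1; rewrite h1 expr1 eqxx.
Qed.

Lemma tits_form_sym (i j : I) : tits_form i j = tits_form j i.
Proof. by rewrite /tits_form cox_entry_sym. Qed.

Lemma contragredientK (i : I) : involutive (contragredient i).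
Proof.
move=> F; apply/funext => k; rewrite /contragredient tits_form_diag; ring.
Qed.

Lemma foldr_flatten_nseq (X : Type) (f : I -> X -> X) (i j : I) (m : nat) F :
  foldr f F (flatten (nseq m [:: i; j])) = iter m (f i \o f j) F.
Proof. by elim: m => //= m ->. Qed.

(* [F i + z F j] is an eigenform of [s_i s_j] for the eigenvalue [z ^ 2];
   applied to [z] and [z^-1] this diagonalises [s_i s_j] on these two coordinates. *)
Lemma contragredient_eigen (i j : I) (n : nat) (F : I -> algC)
    (z : algC) :
  z != 0 -> tits_form i j = - (z + z^-1) ->
  let G := iter n (contragredient i \o contragredient j) F in
  G i + z * G j = z ^+ n.*2 * (F i + z * F j).
Proof.
move=> z0 aij; elim: n => [|n IH] /=; first by rewrite expr0 mul1r.
set G := iter n _ _ in IH *.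
rewrite doubleS !exprS -!mulrA -IH /contragredient /=.
rewrite (tits_form_sym j i) !tits_form_diag aij.
by field.
Qed.

(** The eigenforms for [z] and its inverse get multiplied by a 2m-th power of a 2m-th root of unity,
    that is by 1. They are independent since m >= 2, so the coordinates [i] and [j] return; an
    invariant form then controls every other coordinate. *)
Lemma contragredient_order_dvd (i j : I) (m : nat) :
  i != j -> M i j = Some m ->
  iter m (contragredient i \o contragredient j) =1 id.
Proof.
move=> ij Mij F; have m2 := cox_entry_off ij Mij.
case: m m2 Mij => // m m2 Mij.
have h := half_root_prim m; have z0 := half_root_neq0 (Some m.+1).
have := contragredient_eigen (i := i) (j := j) m.+1 F z0.
have := contragredient_eigen (i := i) (j := j) m.+1 F
  (z := (half_root (Some m.+1))^-1).
rewrite invr_eq0 invrK.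
set z := half_root _ in h z0 *; set G := iter _ _ _.
rewrite /tits_form Mij -/z addrC exprVn (prim_expr_order h) invr1 !mul1r.
move=> /(_ z0 erefl) e1 /(_ erefl) e2.
have zz : z^-1 - z != 0.
  rewrite subr_eq0; apply/eqP => zV.
  have : z ^+ 2 == 1 by rewrite expr2 -{1}zV mulVf.
  rewrite -(prim_order_dvd h) => /dvdn_leq -/(_ isT).
  by rewrite doubleS ltnS; case: (m) m2.
have ej : G j = F j.
  apply: (mulfI zz); rewrite !mulrBl.
  have -> : z^-1 * G j - z * G j = (G i + z^-1 * G j) - (G i + z * G j) by ring.
  by rewrite e1 e2; ring.
have ei : G i = F i by move: e2; rewrite ej => /addIr.
apply/funext => k.
(* Gram determinant of the roots [i] and [j], the denominator of the coefficients below. *)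
have d0 : 4 - tits_form i j ^+ 2 != 0.
  rewrite /tits_form Mij -/z.
  have -> : 4 - (- (z + z^-1)) ^+ 2 = - (z^-1 - z) ^+ 2 by field.
  by rewrite oppr_eq0 expf_neq0.
(* [k] plus a suitable combination of the coordinates [i], [j] is invariant
   under both reflections. *)
pose al := (tits_form i j * tits_form j k - 2 * tits_form i k)
           / (4 - tits_form i j ^+ 2).
pose be := (tits_form i j * tits_form i k - 2 * tits_form j k)
           / (4 - tits_form i j ^+ 2).
pose L (E : I -> algC) := E k + al * E i + be * E j.
have Li E : L (contragredient i E) = L E.
  rewrite /L /al /be /contragredient tits_form_diag.
  move: (tits_form i j) (tits_form i k) (tits_form j k) d0 => a b c d0.
  by field.
have Lj E : L (contragredient j E) = L E.
  rewrite /L /al /be /contragredient tits_form_diag (tits_form_sym j i).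
  move: (tits_form i j) (tits_form i k) (tits_form j k) d0 => a b c d0.
  by field.
have : L G = L F.
  rewrite /G; elim: (m.+1) => //= n <-.
  by rewrite Li Lj.
by rewrite /L ei ej => /addIr/addIr.
Qed.

Lemma cox_rel_contragredient (u v : seq I) :
  word_cong (cox_rel M) u v ->
  foldr contragredient ^~ u =1 foldr contragredient ^~ v.
Proof.
apply: word_cong_foldr => {}u {}v [i j m Mij] F; rewrite foldr_flatten_nseq.
have [ij|/contragredient_order_dvd -> //] := eqVneq i j.
move: Mij; rewrite -ij cox_entry_diag => -[<-] /=.
exact: contragredientK.
Qed.

(** The relation is evaluated on the form dual to the root [i]. For a finite label m the eigenvalue
    forces 2m to divide 2r; for the label infinity the coordinates grow linearly and never
    return. *)
Lemma cox_gen_order (i j : I) (r : nat) :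
  i != j -> (0 < r)%N ->
  word_cong (cox_rel M) (flatten (nseq r [:: i; j])) [::] ->
  exists2 m, M i j = Some m & (m <= r)%N.
Proof.
move=> ij r0 /cox_rel_contragredient H.
pose F (k : I) : algC := (k == i)%:R.
have {}H := H F; rewrite foldr_flatten_nseq /= in H.
have Fi : F i = 1 by rewrite /F eqxx.
have Fj : F j = 0 by rewrite /F eq_sym (negPf ij).
case Mij : (M i j) => [m|].
  exists m => //.
  have m2 := cox_entry_off ij Mij; case: m m2 Mij => // m m2 Mij.
  have h := half_root_prim m; have z0 := half_root_neq0 (Some m.+1).
  have := contragredient_eigen (i := i) (j := j) r F z0.
  rewrite H /tits_form Mij => /(_ erefl)/esym/eqP.
  rewrite Fi Fj mulr0 addr0 mulr1 -(prim_order_dvd h) => /dvdn_leq.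
  by rewrite double_gt0 leq_double; apply.
have aij : tits_form i j = -2 by rewrite /tits_form Mij /= invr1.
have aji : tits_form j i = -2 by rewrite tits_form_sym.
have : iter r (contragredient i \o contragredient j) F i = 1 - (r.*2)%:R /\
       iter r (contragredient i \o contragredient j) F j = (r.*2)%:R.
  elim: (r) => [|n [IHi IHj]] /=; first by rewrite Fi Fj subr0.
  rewrite /contragredient !tits_form_diag aij aji IHi IHj doubleS.
  rewrite (_ : n.*2.+2%:R = n.*2%:R + 2) -?natrD ?addn2 //.
  by split; ring.
rewrite H Fi => -[/eqP + _]; rewrite -[X in X == _]addr0 (inj_eq (addrI _)).
by rewrite eq_sym oppr_eq0 pnatr_eq0 double_eq0; case: (r) r0.
Qed.

End GeometricRepresentation.

(** * Reflections and the exchange condition *)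

Section CoxeterGroup.
Variables (I : finType) (M : coxeter_matrix I).

Definition cox_word (u : seq I) : coxeter M := word_class (cox_rel M) u.

Local Notation s := (cox_gen M).

Lemma cox_word_nil : cox_word [::] = 1. Proof. by []. Qed.

Lemma cox_word_cat (u v : seq I) :
  cox_word (u ++ v) = cox_word u * cox_word v.
Proof. exact: word_class_cat. Qed.

Lemma cox_word_cons (i : I) (u : seq I) : cox_word (i :: u) = s i * cox_word u.
Proof. by rewrite -cat1s cox_word_cat. Qed.

Lemma cox_word_prod (u : seq I) : \prod_(i <- u) s i = cox_word u.
Proof. exact: (prod_pgen (cox_rel M)). Qed.

Lemma cox_genK (i : I) (w : coxeter M) : s i * (s i * w) = w.
Proof. by rewrite mulgA cox_gen_sq mul1g. Qed.

Lemma cox_genV (i : I) : (s i)^-1 = s i.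
Proof. by apply: mulg1_eq; rewrite cox_gen_sq. Qed.

Lemma cox_genJ (i : I) (t : coxeter M) : t ^ s i = s i * t * s i.
Proof. by rewrite conjgE cox_genV mulgA. Qed.

Lemma cox_gen_expg_neq1 (i j : I) (r : nat) :
  i != j -> (0 < r)%N -> (s i * s j) ^+ r = 1 ->
  exists2 m, M i j = Some m & (m <= r)%N.
Proof.
move=> ij r0 h; apply: cox_gen_order => //; apply/word_classP.
change (cox_word (flatten (nseq r [:: i; j])) = cox_word [::]).
rewrite cox_word_nil -[RHS]h; elim: (r) => //= n IH.
by rewrite !cox_word_cons IH mulgA expgS.
Qed.

Lemma cox_lengthE (w : coxeter M) :
  exists2 u, w = cox_word u & size u = cox_length w.
Proof.
rewrite /cox_length; case: ex_minnP => n /asboolP[u un wE] _.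
by exists u; rewrite // -cox_word_prod.
Qed.

Lemma cox_length_word (u : seq I) : (cox_length (cox_word u) <= size u)%N.
Proof.
rewrite /cox_length; case: ex_minnP => n _; apply.
by apply/asboolP; exists u; rewrite // cox_word_prod.
Qed.

Lemma cox_length_gen (i : I) (w : coxeter M) :
  (cox_length (s i * w)%g <= (cox_length w).+1)%N.
Proof.
have [u -> <-] := cox_lengthE w.
by rewrite -cox_word_cons (leq_trans (cox_length_word _)).
Qed.

(* The reflections [s_1 .. s_(k-1) s_k s_(k-1) .. s_1], one per letter. *)
Fixpoint reflections (u : seq I) : seq (coxeter M) :=
  if u is i :: u' then s i :: [seq t ^ s i | t <- reflections u'] else [::].

Lemma reflections_cat (u v : seq I) :
  reflections (u ++ v) =
  reflections u ++ [seq t ^ (cox_word u)^-1 | t <- reflections v].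
Proof.
elim: u => [|i u IH] /=.
  rewrite cox_word_nil -[LHS]map_id; apply: eq_map => t.
  by rewrite invg1 conjg1.
rewrite IH map_cat -map_comp; congr (_ :: _ ++ _).
apply: eq_map => t /=.
by rewrite cox_word_cons invgM cox_genV conjgM.
Qed.

Lemma reflections_alt (i j : I) (n : nat) :
  reflections (alt_word i j n) = mkseq (fun r => (s i * s j) ^+ r * s i) n.
Proof.
elim: n i j => [|n IH] i j //=.
rewrite IH /mkseq /= (iotaDl 1 0) -!map_comp mul1g.
congr (_ :: _); apply: eq_map => r /=.
rewrite cox_genJ add1n -mulgA; elim: r => [|r IHr].
  by rewrite mul1g expg1 mulgA.
rewrite expgS [in RHS]expgS -[in RHS]mulgA -IHr !mulgA.
by rewrite -!mulgA.
Qed.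

Lemma alt_word_double (i j : I) (m : nat) :
  flatten (nseq m [:: i; j]) = alt_word i j (m + m).
Proof. by elim: m => // m IH; rewrite addnS /= IH. Qed.

(** The count depends on the word, its parity only on the element spelled: this is the reflection
    cocycle. *)
Definition inv_parity (u : seq I) (t : coxeter M) : bool :=
  odd (count_mem t (reflections u)).

Lemma count_conj (t x : coxeter M) (r : seq (coxeter M)) :
  count_mem t [seq y ^ x | y <- r] = count_mem (t ^ x^-1) r.
Proof.
rewrite count_map; apply: eq_count => y /=.
by rewrite -(inj_eq (@conjg_inj _ x^-1)) conjgK.
Qed.

(* In the list attached to (ij)^m every reflection occurs an even number of
   times, because the second half of the list repeats the first one. *)
Lemma inv_parity_cong (u v : seq I) :
  word_cong (cox_rel M) u v -> inv_parity u =1 inv_parity v.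
Proof.
elim=> {u v} [x y u v [i j m Mij] t|u t|u v _ IH t|v u w _ IH1 _ IH2 t] //=;
  last by rewrite IH1.
rewrite /inv_parity !reflections_cat map_cat !count_cat !oddD /=.
congr addb; rewrite -[RHS]addFb; congr addb; last first.
  rewrite (_ : cox_word (flatten _) = 1) ?invg1.
    congr (odd (count_mem _ (map _ _))); rewrite -[RHS]map_id.
    by apply: eq_map => r; rewrite conjg1.
  by apply/word_classP; have := WordStep [::] [::] (CoxRel Mij); rewrite !cats0.
rewrite count_conj alt_word_double reflections_alt /mkseq iotaD map_cat.
rewrite count_cat oddD addnC iotaDl -map_comp.
rewrite (_ : map (_ \o _) _ =
  [seq (s i * s j) ^+ r * s i | r <- iota 0 m]) ?addbb //.
by apply: eq_map => r /=; rewrite expgnDr (cox_gen_rel Mij) mul1g.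
Qed.

Lemma inv_parity_cons (i : I) (u : seq I) :
  inv_parity (i :: u) (s i) = ~~ inv_parity u (s i).
Proof.
by rewrite /inv_parity /= eqxx count_conj cox_genV conjgE mulKg.
Qed.

Lemma mem_reflections (t : coxeter M) (u : seq I) :
  t \in reflections u ->
  exists x k y, u = x ++ k :: y /\ t * cox_word u = cox_word (x ++ y).
Proof.
elim: u t => // i u IH t.
rewrite inE => /orP[/eqP ->|/mapP[t' /IH[x [k [y [-> xy]]]] ->]].
  by exists [::], i, u; rewrite /= cox_word_cons cox_genK.
exists (i :: x), k, y; split=> //=.
by rewrite !cox_word_cons -xy cox_genJ -!mulgA cox_genK.
Qed.

(** If [s i] has even parity in [u], it has odd parity in a shortest word [v] of [s i * cox_word u].
    Deleting a letter of [v] then spells [cox_word u] by a word shorter than [v], against the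
    hypothesis. *)
Lemma exchange (i : I) (u : seq I) :
  (cox_length (s i * cox_word u)%g <= cox_length (cox_word u))%N ->
  s i \in reflections u.
Proof.
have oddP v : inv_parity v (s i) -> s i \in reflections v.
  by rewrite /inv_parity -has_pred1 has_count; case: count.
case: (boolP (inv_parity u (s i))) => [/oddP //|].
have [v uv vl] := cox_lengthE (s i * cox_word u).
have uiv : cox_word u = cox_word (i :: v) by rewrite cox_word_cons -uv cox_genK.
have /word_classP/inv_parity_cong -> := uiv.
rewrite inv_parity_cons negbK => /oddP/mem_reflections[x [k [y [vE vxy]]]].
rewrite -vl vE uiv cox_word_cons vxy size_cat /= addnS ltnNge => /negP[].
by rewrite -size_cat cox_length_word.
Qed.

End CoxeterGroup.

(** * Matsumoto's theorem *)

Lemma mulg_expgC (G : monoidType) (x y : G) (n : nat) :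
  (x * y) ^+ n * x = x * (y * x) ^+ n.
Proof.
elim: n => [|n IH]; first by rewrite mulg1 mul1g.
by rewrite expgS -[LHS]mulgA IH [in RHS]expgS !mulgA.
Qed.

Section HeckeMonoid.
Variables (I : finType) (M : coxeter_matrix I).

Local Notation s := (cox_gen M).
Local Notation cw := (cox_word M).
Local Notation len := (@cox_length I M).

Lemma size_alt_word (T : Type) (x y : T) (n : nat) : size (alt_word x y n) = n.
Proof. by elim: n x y => //= n IH x y; rewrite IH. Qed.

(** The exchanged letter cannot lie in the alternating prefix: that would make a power of
    [s i * s j] with positive exponent at most [p] trivial. So it is removed from [x]. *)
Lemma alt_prefix_step (i j : I) (p : nat) (x : seq I) :
  i != j -> (forall m, M i j = Some m -> (p < m)%N) ->
  (len (s j * cw (alt_word i j p ++ x))%g <=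
    len (cw (alt_word i j p ++ x)))%N ->
  exists y, (size y).+1 = size x /\
            cw (alt_word j i p.+1 ++ y) = cw (alt_word i j p ++ x).
Proof.
move=> ij pm /exchange; rewrite reflections_cat mem_cat => /orP[|].
  rewrite reflections_alt => /mapP[r]; rewrite mem_iota add0n => /andP[_ rp] sj.
  have : (s i * s j) ^+ r.+1 = 1 by rewrite expgSr mulgA -sj cox_gen_sq.
  move=> /(cox_gen_expg_neq1 ij) -/(_ isT)[m /pm pm' mr].
  by have := leq_trans pm' (leq_trans mr rp); rewrite ltnn.
move=> /mapP[t /mem_reflections[x1 [k [y1 [xE txy]]]] sj].
exists (x1 ++ y1); split; first by rewrite xE !size_cat addnS.
have {}sj : s j * cw (alt_word i j p ++ x) = cw (alt_word i j p ++ x1 ++ y1).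
  rewrite !(cox_word_cat M (alt_word i j p)) -txy sj conjgE invgK.
  by rewrite -!mulgA mulKg.
by rewrite [alt_word _ _ _.+1]/= cat_cons cox_word_cons -sj cox_genK.
Qed.

Definition reduced (u : seq I) := size u = len (cw u).

Lemma reduced_cons (i : I) (u : seq I) : reduced (i :: u) -> reduced u.
Proof.
rewrite /reduced cox_word_cons /= => h; apply/eqP.
by rewrite eqn_leq cox_length_word andbT -ltnS h cox_length_gen.
Qed.

Definition hecke_word (u : seq I) : hecke M := word_class (hecke_rel M) u.

Lemma hecke_word_cat (u v : seq I) :
  hecke_word (u ++ v) = hecke_word u * hecke_word v.
Proof. exact: word_class_cat. Qed.

Lemma hecke_word_cons (i : I) (u : seq I) :
  hecke_word (i :: u) = hecke_gen M i * hecke_word u.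
Proof. by rewrite -cat1s hecke_word_cat. Qed.

Lemma hecke_wordP (h : hecke M) : exists u, h = hecke_word u.
Proof.
exists (repr (h : presented (hecke_rel M))).
by rewrite /hecke_word word_class_repr.
Qed.

Lemma hecke_word_prod (u : seq I) : \prod_(i <- u) hecke_gen M i = hecke_word u.
Proof. exact: (prod_pgen (hecke_rel M)). Qed.

Lemma hecke_gen_sq (i : I) : hecke_gen M i * hecke_gen M i = hecke_gen M i.
Proof.
rewrite -[LHS](hecke_word_cat [:: i] [:: i]); apply/word_classP.
exact: (WordStep [::] [::] (HeckeIdem M i)).
Qed.

Lemma hecke_braid (i j : I) (m : nat) : i != j -> M i j = Some m ->
  hecke_word (alt_word i j m) = hecke_word (alt_word j i m).
Proof.
move=> ij Mij; apply/word_classP.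
by have := WordStep [::] [::] (HeckeBraid ij Mij); rewrite !cats0.
Qed.

Lemma cox_alt_word (i j : I) (n : nat) :
  (s i * s j) ^+ n * cw (alt_word j i n) = cw (alt_word i j n).
Proof.
elim: n i j => [|n IH] i j; first by rewrite mulg1.
rewrite /= !cox_word_cons -(IH j i) expgSr -!mulgA cox_genK.
by rewrite !mulgA mulg_expgC.
Qed.

Lemma cox_braid (i j : I) (m : nat) : M i j = Some m ->
  cw (alt_word i j m) = cw (alt_word j i m).
Proof. by move/(cox_gen_rel (M := M)) => h; rewrite -cox_alt_word h mul1g. Qed.

(* If a reduced word of [w] starts with [i] and another one with [j], then
   exchanging produces reduced words starting with ever longer alternating
   prefixes, until the prefixes are the two sides of the braid relation. *)
Lemma matsumoto (u v : seq I) :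
  reduced u -> reduced v -> cw u = cw v -> hecke_word u = hecke_word v.
Proof.
move: {2}(size u) (leqnn (size u)) => n.
elim: n u v => [|n IHn] [|i u] [|j v] //; rewrite /reduced.
- by move=> _ + + uv; rewrite -uv => <-.
- by move=> _ + + uv; rewrite -uv => <-.
- by move=> _ + + uv; rewrite uv => <-.
rewrite ltnS => un ru rv uv.
(* Words with the same first letter: cancel it and apply induction to the tails. *)
have tailE k x y : cw (k :: x) = cw (k :: y) ->
    size (k :: x) = len (cw (k :: x)) ->
    size (k :: y) = size (k :: x) -> size (k :: x) = (size u).+1 ->
    hecke_word (k :: x) = hecke_word (k :: y).
  move=> xy rx szy szx; rewrite !hecke_word_cons; congr (_ * _).
  have ry : reduced (k :: y) by rewrite /reduced szy -xy.
  apply: IHn; [|exact: reduced_cons rx|exact: reduced_cons ry|].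
    by case: szx => ->.
  by move: xy; rewrite !cox_word_cons => /mulgI.
have [vu] : size (j :: v) = size (i :: u) by rewrite ru rv uv.
have [ij|ij] := eqVneq i j.
  by rewrite -ij in uv rv *; apply: tailE => //=; rewrite vu.
have prefix p : (forall m, M i j = Some m -> (p < m)%N) ->
  exists x y, [/\ cw (alt_word i j p.+1 ++ x) = cw (i :: u),
    cw (alt_word j i p.+1 ++ y) = cw (i :: u),
    size (alt_word i j p.+1 ++ x) = (size u).+1 &
    size (alt_word j i p.+1 ++ y) = (size u).+1].
  elim: p => [|p IHp] pm; first by exists u, v; rewrite /= vu uv.
  case: IHp => [m /pm /ltnW //|x [y [xw yw sx sy]]].
  have pm' m : M j i = Some m -> (p.+1 < m)%N.
    by rewrite cox_entry_sym; apply: pm.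
  have [|y' [y's y'w]] := @alt_prefix_step i j p.+1 x ij pm.
    rewrite xw -ru uv cox_word_cons cox_genK.
    by apply: leq_trans (cox_length_word M v) _; rewrite vu.
  have [||x' [x's x'w]] := @alt_prefix_step j i p.+1 y _ pm'.
  - by rewrite eq_sym.
  - rewrite yw -ru cox_word_cons cox_genK.
    exact: leq_trans (cox_length_word M u) _.
  exists x', y'; rewrite y'w x'w xw yw; split=> //.
  - by rewrite -sy !size_cat !size_alt_word -x's addSnnS.
  - by rewrite -sx !size_cat !size_alt_word -y's addSnnS.
case Mij : (M i j) => [m|]; last first.
  (* For the label infinity the prefix would outgrow the whole word. *)
  have [|x [y [_ _ + _]]] := prefix (size u).+1; first by move=> m; rewrite Mij.
  rewrite size_cat size_alt_word => /eqP.
  by rewrite -{2}[(size u).+1]addn0 addSnnS eqn_add2l.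
have m2 := cox_entry_off ij Mij.
case: m m2 Mij => // m m2 Mij.
have [|x [y [xw yw sx sy]]] := prefix m.
  by move=> m'; rewrite Mij => -[<-].
have eu : hecke_word (i :: u) = hecke_word (alt_word i j m.+1 ++ x).
  exact: tailE.
(* By the braid relation in the group, the same tail [x] completes the other prefix. *)
have ev : hecke_word (j :: v) = hecke_word (alt_word j i m.+1 ++ x).
  have vx : cw (j :: v) = cw (alt_word j i m.+1 ++ x).
    by rewrite -uv -xw !cox_word_cat (cox_braid Mij).
  by apply: (tailE _ _ _ vx rv); rewrite /= vu // -sx !size_cat !size_alt_word.
by rewrite eu ev !hecke_word_cat (hecke_braid ij Mij).
Qed.

End HeckeMonoid.

(** * The Bruhat order on the Hecke monoid *)

Section BruhatOrder.
Variables (I : finType) (M : coxeter_matrix I).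

Local Notation s := (cox_gen M).
Local Notation cw := (cox_word M).
Local Notation len := (@cox_length I M).
Local Notation hw := (hecke_word M).

(** When [s i] does not lengthen, exchange moves a letter to the front as [i]. By Matsumoto the new
    word has the same Hecke class, which the idempotent generator fixes. *)
Lemma reduced_cons_or_absorb (i : I) (u : seq I) : reduced M u ->
  reduced M (i :: u) \/
  hecke_gen M i * hw u = hw u /\
  exists v, [/\ subseq v u, reduced M v & s i * cw u = cw v].
Proof.
move=> ru; have [lt|le] := ltnP (len (cw u)) (len (s i * cw u)).
  left; apply/eqP; rewrite /reduced cox_word_cons eqn_leq /= ru lt.
  by rewrite -cox_word_cons -ru cox_length_word.
right; have /mem_reflections[x [k [y [uE xy]]]] := exchange le.
have uv : cw (i :: x ++ y) = cw u by rewrite cox_word_cons -xy cox_genK.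
have rv : reduced M (i :: x ++ y).
  by rewrite /reduced uv -ru uE /= !size_cat addnS.
split; last first.
  exists (x ++ y); split=> //; last exact: reduced_cons rv.
  by rewrite uE cat_subseq // subseq_cons.
by rewrite -(matsumoto rv ru uv) hecke_word_cons mulgA hecke_gen_sq.
Qed.

(** Being a subword keeps the letters of [v] in any subset [J] containing those of [u]. *)
Lemma cox_word_reduced (u : seq I) :
  exists v, [/\ subseq v u, reduced M v & cw u = cw v].
Proof.
elim: u => [|i u [v [vu rv uv]]].
  exists [::]; split=> //; apply/esym/eqP.
  by rewrite -leqn0 (cox_length_word M [::]).
have [riv|[_ [v' [v'v rv' v'E]]]] := reduced_cons_or_absorb i rv.
  by exists (i :: v); rewrite /= eqxx !cox_word_cons uv.
exists v'; split=> //; last by rewrite cox_word_cons uv v'E.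
exact: subseq_trans v'v (subseq_trans vu (subseq_cons _ _)).
Qed.

Lemma hecke_word_reduced (u : seq I) :
  exists v, [/\ subseq v u, reduced M v & hw u = hw v].
Proof.
elim: u => [|i u [v [vu rv uv]]].
  exists [::]; split=> //; apply/esym/eqP.
  by rewrite -leqn0 (cox_length_word M [::]).
have [riv|[iv _]] := reduced_cons_or_absorb i rv.
  by exists (i :: v); rewrite /= eqxx !hecke_word_cons uv.
exists v; split=> //; last by rewrite hecke_word_cons uv iv.
exact: subseq_trans vu (subseq_cons _ _).
Qed.

Lemma to_hecke_reduced (u : seq I) : reduced M u -> to_hecke (cw u) = hw u.
Proof.
move=> ru; rewrite /to_hecke hecke_word_prod /reduced_word.
set P := (X in xget _ X).
have [vE vl] : P (xget [::] P).
  by apply: xgetPex; exists u; split; rewrite // cox_word_prod.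
rewrite cox_word_prod in vE.
by apply: matsumoto; rewrite // /reduced -vE.
Qed.

(* The word [s_1 .. s_n] acts on [A] as product with {1, s_1} .. {1, s_n}. *)
Definition bruhat_act (i : I) (A : set (coxeter M)) : set (coxeter M) :=
  (A `|` [set s i * a | a in A])%classic.

Lemma bruhat_actE (i : I) (A : set (coxeter M)) (w : coxeter M) :
  bruhat_act i A w <-> A w \/ A (s i * w).
Proof.
split=> [[|[a Aa <-]]|[|Aw]]; [by left|by right; rewrite cox_genK|by left|].
by right; exists (s i * w); rewrite ?cox_genK.
Qed.

(** The description is symmetric in [i] and [j] except at full length [n], where the two elements
    agree if [n] is the label. *)
Lemma bruhat_act_alt (i j : I) (n : nat) (A : set (coxeter M)) w :
  foldr bruhat_act A (alt_word i j n) w <->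
  (exists2 p, (p <= n)%N & exists2 a, A a & w = cw (alt_word i j p) * a) \/
  (exists2 p, (p < n)%N & exists2 a, A a & w = cw (alt_word j i p) * a).
Proof.
elim: n i j w => [|n IH] i j w /=.
  split=> [Aw|[[[|//] _ [a Aa ->]]|[] //]]; last by rewrite cox_word_nil mul1g.
  by left; exists 0%N => //; exists w => //; rewrite cox_word_nil mul1g.
have consE x y p a : (s x * w = cw (alt_word y x p) * a) <->
                 (w = cw (alt_word x y p.+1) * a).
  rewrite /= cox_word_cons -mulgA; split=> [<-|->]; by rewrite cox_genK.
rewrite bruhat_actE !IH; split.
- case=> [[[p pn aE]|[p pn aE]]|[[p pn [a Aa /consE aE]]|[p pn [a Aa aE]]]].
  + by right; exists p.
  + by left; exists p => //; rewrite ltnW // ltnS ltnW.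
  + by left; exists p.+1 => //; exists a.
  + case: p pn aE => [|p] pn aE.
      left; exists 1%N => //; exists a => //.
      by rewrite -consE aE.
    right; exists p; first by rewrite ltnS ltnW // ltnW.
    exists a => //; move: aE; rewrite /= cox_word_cons -mulgA.
    by move/mulgI.
- case=> [[[|p] pn [a Aa aE]]|[p pn aE]].
  + by left; left; exists 0%N => //; exists a.
  + by right; left; exists p => //; exists a => //; apply/consE.
  + by left; left; exists p.
Qed.

Lemma bruhat_act_cong (u v : seq I) : word_cong (hecke_rel M) u v ->
  foldr bruhat_act ^~ u =1 foldr bruhat_act ^~ v.
Proof.
apply: word_cong_foldr => {}u {}v [i|i j m ij Mij] A; apply/seteqP.
  rewrite /=; split=> w; rewrite !bruhat_actE ?cox_genK; tauto.
split=> w; rewrite !bruhat_act_alt.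
- case=> [[p]|[p pm]]; last by left; exists p; rewrite // ltnW.
  rewrite leq_eqVlt => /orP[/eqP ->|pm]; last by right; exists p.
  by left; exists m; rewrite // -(cox_braid Mij).
- case=> [[p]|[p pm]]; last by left; exists p; rewrite // ltnW.
  rewrite leq_eqVlt => /orP[/eqP ->|pm]; last by right; exists p.
  by left; exists m; rewrite // (cox_braid Mij).
Qed.

Lemma sub_bruhat_act (u : seq I) (A : set (coxeter M)) :
  (A `<=` foldr bruhat_act A u)%classic.
Proof. by elim: u => //= i u IH; apply: subset_trans IH _; apply: subsetUl. Qed.

Lemma bruhat_actM (u : seq I) (A : set (coxeter M)) (w : coxeter M) :
  foldr bruhat_act A u w <->
  exists x y, [/\ foldr bruhat_act [set 1]%classic u x, A y & w = x * y].
Proof.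
elim: u w => [|i u IH] w.
  split=> [Aw|[x [y [-> Ay ->]]]]; last by rewrite mul1g.
  by exists 1, w; rewrite mul1g.
rewrite /= bruhat_actE !IH; split.
  case=> [[x [y [ux Ay ->]]]|[x [y [ux Ay wE]]]].
    by exists x, y; split=> //; left.
  exists (s i * x), y; split=> //; last by rewrite -mulgA -wE cox_genK.
  by apply/bruhat_actE; right; rewrite cox_genK.
case=> x [y [/bruhat_actE[ux|ux] Ay ->]]; [left|right].
  by exists x, y.
by exists (s i * x), y; rewrite mulgA.
Qed.

(** By the subword property, the lower Bruhat interval of the element of W(M) identified with
    [h]. *)
Definition bruhat_ideal (h : hecke M) : set (coxeter M) :=
  foldr bruhat_act [set 1]%classic (repr (h : presented (hecke_rel M))).

Lemma bruhat_idealE (u : seq I) :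
  bruhat_ideal (hw u) = foldr bruhat_act [set 1]%classic u.
Proof.
by apply: bruhat_act_cong; apply/word_classP; rewrite word_class_repr.
Qed.

Lemma bruhat_ideal1 (h : hecke M) : bruhat_ideal h 1.
Proof. exact: sub_bruhat_act. Qed.

Lemma bruhat_idealM (g h : hecke M) (w : coxeter M) :
  bruhat_ideal (g * h) w <->
  exists x y, [/\ bruhat_ideal g x, bruhat_ideal h y & w = x * y].
Proof.
have [u ->] := hecke_wordP g; have [v ->] := hecke_wordP h.
by rewrite -hecke_word_cat !bruhat_idealE foldr_cat bruhat_actM.
Qed.

Lemma finite_bruhat_ideal (h : hecke M) : finite_set (bruhat_ideal h).
Proof.
rewrite /bruhat_ideal; elim: (repr _) => [|i u IH] /=; first exact: finite_set1.
by rewrite /bruhat_act finite_setU; split=> //; apply: finite_image.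
Qed.

Lemma bruhat_ideal_word (u : seq I) : bruhat_ideal (hw u) (cw u).
Proof.
rewrite bruhat_idealE; elim: u => // i u IH.
by apply/bruhat_actE; right; rewrite cox_word_cons cox_genK.
Qed.

(** Each letter contributes itself or 1, so a member other than [cox_word M u] is spelled by a
    proper subword. *)
Lemma bruhat_ideal_length (u : seq I) (w : coxeter M) :
  bruhat_ideal (hw u) w -> w = cw u \/ (len w < size u)%N.
Proof.
rewrite bruhat_idealE; elim: u w => [|i u IH] w; first by left.
case/bruhat_actE => /IH[wE|wl].
- by right; rewrite wE ltnS cox_length_word.
- by right; apply: ltnW.
- by left; rewrite cox_word_cons -wE cox_genK.
- right; rewrite ltnS -[w](cox_genK i).
  exact: leq_trans (cox_length_gen _ _) wl.
Qed.

Definition bruhat_le (g h : hecke M) : Prop :=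
  (bruhat_ideal g `<=` bruhat_ideal h)%classic.

Local Infix "<=B" := bruhat_le (at level 70).

Lemma bruhat_le_trans (f g h : hecke M) : f <=B g -> g <=B h -> f <=B h.
Proof. exact: subset_trans. Qed.

(** For reduced words, each product lies in the other ideal. They cannot both be strictly shorter,
    so they are equal and Matsumoto applies. *)
Lemma bruhat_le_anti (g h : hecke M) : g <=B h -> h <=B g -> g = h.
Proof.
have [g' ->] := hecke_wordP g; have [u [_ ru ->]] := hecke_word_reduced g'.
have [h' ->] := hecke_wordP h; have [v [_ rv ->]] := hecke_word_reduced h'.
move=> /(_ _ (bruhat_ideal_word u))/bruhat_ideal_length uv.
move=> /(_ _ (bruhat_ideal_word v))/bruhat_ideal_length vu.
apply: matsumoto => //; case: uv => // uv; case: vu => // vu.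
by move: uv vu; rewrite -ru -rv => /ltn_trans/[apply]; rewrite ltnn.
Qed.

Lemma bruhat_leM (f g f' g' : hecke M) :
  f <=B f' -> g <=B g' -> f * g <=B f' * g'.
Proof.
move=> ff gg w /bruhat_idealM[x [y [/ff fx /gg gy ->]]].
by apply/bruhat_idealM; exists x, y.
Qed.

Lemma bruhat_le1 (h : hecke M) : 1 <=B h.
Proof.
by move=> w; rewrite -[1]/(hw [::]) bruhat_idealE => ->; apply: bruhat_ideal1.
Qed.

Lemma bruhat_le_mulr (g h : hecke M) : g <=B g * h.
Proof. by rewrite -{1}[g]mulg1; apply: bruhat_leM (bruhat_le1 h). Qed.

Lemma bruhat_le_mull (g h : hecke M) : h <=B g * h.
Proof. by rewrite -{1}[h]mul1g; apply: bruhat_leM (bruhat_le1 g) _. Qed.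

End BruhatOrder.

(** * Longest elements and idempotents *)

Section Parabolic.
Variables (I : finType) (M : coxeter_matrix I).

Local Notation s := (cox_gen M).
Local Notation cw := (cox_word M).
Local Notation hw := (hecke_word M).
Local Notation len := (@cox_length I M).
Local Infix "<=B" := (@bruhat_le I M) (at level 70).

Lemma parabolicP (J : {set I}) (w : coxeter M) :
  parabolic M J w <-> exists2 u, {subset u <= J} & w = cw u.
Proof.
split=> [|[u + ->]].
- pose X := [set w | exists2 u, {subset u <= J} & w = cw u]%classic.
  suff : (parabolic M J `<=` X)%classic by apply.
  apply: smallest_sub => [|_ [j jJ <-]]; last first.
    exists [:: j]; last by rewrite cox_word_cons mulg1.
    by move=> k; rewrite inE => /eqP ->.
  split=> [|_ _ [u uJ ->] [v vJ ->]|_ [u uJ ->]].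
  + by exists [::].
  + exists (u ++ v); last by rewrite cox_word_cat.
    by move=> k; rewrite mem_cat => /orP[/uJ|/vJ].
  + exists (rev u); first by move=> k; rewrite mem_rev => /uJ.
    apply/esym; rewrite -[LHS]invgK; congr (_^-1); apply: mulg1_eq.
    exact: word_class_revK.
- elim: u => [|i u IH] uJ X XJ; have [[X1 XM XV] JX] := XJ; first exact: X1.
  rewrite cox_word_cons; apply: XM; last first.
    by apply: (IH _ X XJ) => k ku; apply: uJ; rewrite inE ku orbT.
  by apply: JX; exists i => //=; apply: uJ; rewrite mem_head.
Qed.

Lemma parabolicM (J : {set I}) (v w : coxeter M) :
  parabolic M J v -> parabolic M J w -> parabolic M J (v * w).
Proof.
move=> /parabolicP[u uJ ->] /parabolicP[u' u'J ->]; apply/parabolicP.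
exists (u ++ u'); last by rewrite cox_word_cat.
by move=> k; rewrite mem_cat => /orP[/uJ|/u'J].
Qed.

Lemma parabolic_gen (J : {set I}) (j : I) : j \in J -> parabolic M J (s j).
Proof.
move=> jJ; apply/parabolicP; exists [:: j]; last by rewrite cox_word_cons mulg1.
by move=> k; rewrite inE => /eqP ->.
Qed.

Lemma longestP (J : {set I}) : finite_set (parabolic M J) ->
  parabolic M J (longest M J) /\
  forall v, parabolic M J v -> (len v <= len (longest M J))%N.
Proof.
move=> /finite_seqP[r rE]; rewrite /longest.
set P := (X in xget _ X); suff : P (xget 1 P) by [].
apply: xgetPex.
have r1 : 1 \in r.
  suff : [set` r]%classic 1 by [].
  by rewrite -rE; apply/parabolicP; exists [::].
have lt1 : (index 1%g r < size r)%N by rewrite index_mem.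
have [k _ kmax] := arg_maxnP (fun k : 'I_(size r) => len (nth 1 r k))
  (P := xpredT) (i0 := Ordinal lt1) isT.
exists (nth 1 r k); rewrite /P /=.
have -> : parabolic M J = [set` r]%classic by [].
split; first exact: mem_nth.
move=> v /= vr; have lt : (index v r < size r)%N by rewrite index_mem.
by have := kmax (Ordinal lt) isT; rewrite /= nth_index.
Qed.

Definition hecke_parabolic (J : {set I}) (h : hecke M) : Prop :=
  exists2 u, {subset u <= J} & h = hw u.

Lemma hecke_parabolicM (J : {set I}) (g h : hecke M) :
  hecke_parabolic J g -> hecke_parabolic J h -> hecke_parabolic J (g * h).
Proof.
move=> [u uJ ->] [v vJ ->]; exists (u ++ v); last by rewrite hecke_word_cat.
by move=> k; rewrite mem_cat => /orP[/uJ|/vJ].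
Qed.

Lemma hecke_parabolicS (J K : {set I}) (h : hecke M) :
  J \subset K -> hecke_parabolic J h -> hecke_parabolic K h.
Proof. by move=> /fintype.subsetP JK [u uJ ->]; exists u => // k /uJ/JK. Qed.

Lemma hecke_parabolic_absorb (J : {set I}) (h z : hecke M) :
  (forall k, k \in J -> hecke_gen M k * z = z) ->
  hecke_parabolic J h -> h * z = z.
Proof.
move=> Jz [u uJ ->]; elim: u uJ => [|i u IH] uJ; first exact: mul1g.
rewrite hecke_word_cons -mulgA IH ?Jz ?uJ ?mem_head //.
by move=> k ku; rewrite uJ // inE ku orbT.
Qed.

Lemma hecke_longest_parabolic (J : {set I}) : finite_set (parabolic M J) ->
  hecke_parabolic J (hecke_longest M J).
Proof.
move=> /longestP[/parabolicP[u uJ uE] _].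
have [v [vu rv vE]] := cox_word_reduced M u.
exists v; first by move=> k /(mem_subseq vu)/uJ.
by rewrite /hecke_longest uE vE to_hecke_reduced.
Qed.

(** Otherwise [s_k] would lengthen the longest element inside W_J. *)
Lemma hecke_gen_longest (J : {set I}) (k : I) : finite_set (parabolic M J) ->
  k \in J -> hecke_gen M k * hecke_longest M J = hecke_longest M J.
Proof.
move=> /longestP[pJ max] kJ; rewrite /hecke_longest.
have [u uE ru] := cox_lengthE (longest M J).
have {}ru : reduced M u by rewrite /reduced -uE.
rewrite uE to_hecke_reduced //.
have [rku|[-> //]] := reduced_cons_or_absorb k ru.
have := max _ (parabolicM (parabolic_gen kJ) pJ).
by rewrite uE -cox_word_cons -rku -ru /= ltnn.
Qed.

(* A right zero of the submonoid generated by [J] bounds it in the Bruhat order,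
   so there is at most one, and it exists only for finite [W_J]. *)
Lemma right_zero_longest (J : {set I}) (z : hecke M) :
  hecke_parabolic J z -> (forall k, k \in J -> hecke_gen M k * z = z) ->
  finite_set (parabolic M J) /\ z = hecke_longest M J.
Proof.
move=> zJ Jz; have zmax := hecke_parabolic_absorb Jz.
have fJ : finite_set (parabolic M J).
  apply: sub_finite_set (finite_bruhat_ideal z) => w /parabolicP[u uJ ->].
  rewrite -(zmax (hw u)); last by exists u.
  exact: bruhat_le_mulr (bruhat_ideal_word _ _).
split=> //; have hJ := hecke_longest_parabolic fJ.
apply: bruhat_le_anti.
- have := hecke_parabolic_absorb (fun k => hecke_gen_longest fJ) zJ.
  by move=> <-; apply: bruhat_le_mulr.
- by rewrite -(zmax _ hJ); apply: bruhat_le_mulr.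
Qed.

Lemma bruhat_le_longest (J : {set I}) (h : hecke M) :
  finite_set (parabolic M J) -> hecke_parabolic J h -> h <=B hecke_longest M J.
Proof.
move=> fJ hJ.
rewrite -(hecke_parabolic_absorb (fun k => hecke_gen_longest fJ) hJ).
exact: bruhat_le_mulr.
Qed.

Lemma hecke_longest_idem (J : {set I}) : finite_set (parabolic M J) ->
  hecke_longest M J * hecke_longest M J = hecke_longest M J.
Proof.
move=> fJ; apply: hecke_parabolic_absorb (hecke_longest_parabolic fJ).
by move=> k; apply: hecke_gen_longest.
Qed.

(** [J] is the set of letters of a word of [e]. Peeling off its first letter [i], the remaining
    factor times [e] lies between [e] and [e], so it equals [e], and [s_i] fixes [e]. *)
Lemma hecke_idempotent (e : hecke M) : e * e = e ->
  exists J, finite_set (parabolic M J) /\ e = hecke_longest M J.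
Proof.
have [u uE] := hecke_wordP e; move=> ee.
have absorb v : hw v * e = e -> forall k, k \in v -> hecke_gen M k * e = e.
  elim: v => [|i v IH] // ve.
  have ve' : hw v * e = e.
    apply: bruhat_le_anti; last exact: bruhat_le_mull.
    by rewrite -{2}ve hecke_word_cons -mulgA; apply: bruhat_le_mull.
  move=> k; rewrite inE => /orP[/eqP ->|]; last exact: IH.
  by rewrite -{1}ve' mulgA -hecke_word_cons.
exists [set k in u]; apply: right_zero_longest.
- by exists u => // k; rewrite inE.
- by move=> k; rewrite inE; apply: absorb; rewrite -uE.
Qed.

End Parabolic.

(** * Alternating products of longest elements *)

Section AlternatingProducts.
Variables (I : finType) (M : coxeter_matrix I).
Local Infix "<=B" := (@bruhat_le I M) (at level 70).

Lemma alt_prodS (G : monoidType) (x y : G) (m : nat) :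
  alt_prod x y m.+1 = x * alt_prod y x m.
Proof. by rewrite /alt_prod /= big_cons. Qed.

Lemma alt_prod_le (x y : hecke M) (m n : nat) :
  (m <= n)%N -> alt_prod x y m <=B alt_prod x y n.
Proof.
elim: m n x y => [|m IH] [|n] x y mn //.
- by rewrite {1}/alt_prod big_nil; apply: bruhat_le1.
- by rewrite !alt_prodS; apply: bruhat_leM => //; apply: IH.
Qed.

Variables (J K : {set I}).
Hypotheses (fJ : finite_set (parabolic M J)) (fK : finite_set (parabolic M K)).
Local Notation x := (hecke_longest M J).
Local Notation y := (hecke_longest M K).

Lemma alt_prod_parabolic (m : nat) :
  hecke_parabolic (J :|: K) (alt_prod x y m) /\
  hecke_parabolic (J :|: K) (alt_prod y x m).
Proof.
elim: m => [|m [IHx IHy]].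
  by rewrite /alt_prod !big_nil; split; exists [::].
rewrite !alt_prodS; split; apply: hecke_parabolicM => //.
  exact: hecke_parabolicS (finset.subsetUl _ _) (hecke_longest_parabolic fJ).
exact: hecke_parabolicS (finset.subsetUr _ _) (hecke_longest_parabolic fK).
Qed.

(** The common value can start with either [x] or [y], so every generator in [J] or [K] fixes it: it
    is a right zero. *)
Lemma braid_longest (m : nat) : (0 < m)%N ->
  alt_prod x y m = alt_prod y x m ->
  finite_set (parabolic M (J :|: K)) /\ mu_set M J K m.
Proof.
case: m => // m _ xy.
have xz : x * alt_prod x y m.+1 = alt_prod x y m.+1.
  by rewrite alt_prodS mulgA hecke_longest_idem.
have yz : y * alt_prod x y m.+1 = alt_prod x y m.+1.
  by rewrite xy alt_prodS mulgA hecke_longest_idem.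
have [fJK zE] : finite_set (parabolic M (J :|: K)) /\
    alt_prod x y m.+1 = hecke_longest M (J :|: K).
  apply: right_zero_longest; first by case: (alt_prod_parabolic m.+1).
  move=> k; rewrite inE => /orP[kJ|kK].
    by rewrite -xz mulgA hecke_gen_longest.
  by rewrite -yz mulgA hecke_gen_longest.
by [].
Qed.

Hypothesis fJK : finite_set (parabolic M (J :|: K)).

Lemma mu_set_exists : exists m, mu_set M J K m.
Proof.
have [u uJK uE] := hecke_longest_parabolic fJK.
(* Each letter of [u] lies below [x * y], which costs two factors; the extra one makes the number
   positive when [u] is empty. *)
exists (size u).*2.+1; split=> //; apply: bruhat_le_anti.
  by apply: bruhat_le_longest => //; case: (alt_prod_parabolic (size u).*2.+1).
apply: bruhat_le_trans (@alt_prod_le x y _ _ (leqnSn _)).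
rewrite uE; elim: {uE} u uJK => [|k u IH] uJK; first exact: bruhat_le1.
rewrite hecke_word_cons [size _]/= doubleS !alt_prodS mulgA.
apply: bruhat_leM; last by apply: IH => k' k'u; rewrite uJK // inE k'u orbT.
have := uJK k; rewrite mem_head inE => /(_ isT)/orP[kJ|kK].
  rewrite -(hecke_gen_longest fJ kJ) -mulgA; exact: bruhat_le_mulr.
rewrite -(hecke_gen_longest fK kK).
by apply: bruhat_le_trans (@bruhat_le_mull _ _ x _); apply: bruhat_le_mulr.
Qed.

(** Alternating products increase with the number of factors and are bounded by the longest element,
    so they stay there once they reach it. *)
Lemma mu_set_leq (m n : nat) : mu_set M J K m -> (m <= n)%N -> mu_set M J K n.
Proof.
move=> [m0 mE] mn; split; first exact: leq_trans m0 mn.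
apply: bruhat_le_anti; last by rewrite -mE; apply: alt_prod_le.
by apply: bruhat_le_longest => //; case: (alt_prod_parabolic n).
Qed.

Lemma mu_setE (m : nat) : mu_set M J K m <-> (mu M J K <= m)%N.
Proof.
have [muP mu_min] : mu_set M J K (mu M J K) /\
    forall n, mu_set M J K n -> (mu M J K <= n)%N.
  rewrite /mu; set P := (X in xget _ X); suff : P (xget 0%N P) by [].
  apply: xgetPex; have [m0 m0P] := mu_set_exists.
  have exP : exists n, `[< mu_set M J K n >] by exists m0; apply/asboolP.
  case: (ex_minnP exP) => n /asboolP nP nmin; exists n; split=> // n' /asboolP.
  exact: nmin.
by split=> [/mu_min|/(mu_set_leq muP)].
Qed.

End AlternatingProducts.

(** * Homomorphisms between Hecke monoids *)

Lemma prod_alt_word (T : Type) (G : monoidType) (g : T -> G) (i j : T)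
    (m : nat) :
  \prod_(k <- alt_word i j m) g k = alt_prod (g i) (g j) m.
Proof.
elim: m i j => [|m IH] i j; first by rewrite /alt_prod /= !big_nil.
by rewrite /alt_prod /= !big_cons IH.
Qed.

Lemma hecke_hom_admissible (I I' : finType) (M : coxeter_matrix I)
    (M' : coxeter_matrix I') (K : I' -> {set I})
    (phi : UMagmaMorphism.type (hecke M') (hecke M)) :
  (forall i, finite_set (parabolic M (K i))) ->
  (forall i, phi (hecke_gen M' i) = hecke_longest M (K i)) ->
  mu_admissible M M' K.
Proof.
move=> fK phiE i j ij; case Mij : (M' i j) => [m|]; [right|by left].
have m0 : (0 < m)%N := ltnW (cox_entry_off ij Mij).
have altE i1 j1 : phi (hecke_word M' (alt_word i1 j1 m)) =
    alt_prod (hecke_longest M (K i1)) (hecke_longest M (K j1)) m.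
  rewrite -hecke_word_prod gmulf_prod -!phiE.
  by rewrite -(prod_alt_word (fun k => phi (hecke_gen M' k))).
have braid : alt_prod (hecke_longest M (K i)) (hecke_longest M (K j)) m =
    alt_prod (hecke_longest M (K j)) (hecke_longest M (K i)) m.
  by rewrite -!altE (hecke_braid ij Mij).
have [fij mij] := braid_longest (fK i) (fK j) m0 braid.
have [fji mji] := braid_longest (fK j) (fK i) m0 (esym braid).
exists m => //; split=> //; rewrite geq_max.
by apply/andP; split; apply/mu_setE.
Qed.

Lemma admissible_hecke_hom (I I' : finType) (M : coxeter_matrix I)
    (M' : coxeter_matrix I') (K : I' -> {set I}) :
  (forall i, finite_set (parabolic M (K i))) -> mu_admissible M M' K ->
  exists phi : UMagmaMorphism.type (hecke M') (hecke M),
    forall i, phi (hecke_gen M' i) = hecke_longest M (K i).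
Proof.
move=> fK adm.
apply: (@presented_univ _ (hecke_rel M')) => u v [i|i j m ij Mij].
  by rewrite !big_cons big_nil !mulg1 hecke_longest_idem.
rewrite !prod_alt_word; have [|[m']] := adm _ _ ij; rewrite Mij //.
move=> -[<-] [fij]; rewrite geq_max => /andP[mij mji].
have fji : finite_set (parabolic M (K j :|: K i)) by rewrite finset.setUC.
(* With [m] at least both values of [mu], each side of the braid relation has reached the longest
   element of the union. *)
have [_ ->] := (mu_setE (fK i) (fK j) fij m).2 mij.
have [_ ->] := (mu_setE (fK j) (fK i) fji m).2 mji.
by rewrite finset.setUC.
Qed.

Theorem theorem1p4 (I I' : finType) (M : coxeter_matrix I)
    (M' : coxeter_matrix I') :
  (forall K : I' -> {set I},
     (forall i, finite_set (parabolic M (K i))) ->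
     ((exists phi : UMagmaMorphism.type (hecke M') (hecke M),
         forall i, phi (hecke_gen M' i) = hecke_longest M (K i))
      <-> mu_admissible M M' K))
  /\
  (forall phi : UMagmaMorphism.type (hecke M') (hecke M),
     exists K : I' -> {set I},
       [/\ forall i, finite_set (parabolic M (K i)),
           mu_admissible M M' K &
           forall i, phi (hecke_gen M' i) = hecke_longest M (K i)]).
Proof.
split=> [K fK|phi].
  split=> [[phi]|]; first exact: hecke_hom_admissible.
  exact: admissible_hecke_hom.
(* Generators are idempotent, hence so are their images, and each image selects a subset. *)
have /choice[K KE] (i : I') : exists J, finite_set (parabolic M J) /\
    phi (hecke_gen M' i) = hecke_longest M J.
  by apply: hecke_idempotent; rewrite -gmulfM hecke_gen_sq.
exists K; have fK i := (KE i).1; have phiE i := (KE i).2.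
by split=> //; apply: hecke_hom_admissible phiE.
Qed.
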